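(* Let $f$ be a multiplicative graph invariant with $f(F)\neq 0$ for every graph $F$. Let $G$ be a graph, let $H$ be an induced subgraph of $G$, and put $X=N(V(H))\setminus V(H)$. Then $vs_f(G)\leq |X|+vs_f(H)$.
   Context: All graphs are finite and simple (the graph with no vertices is allowed). An invariant is a function $f$ from graphs to $[0,\infty)$ that is constant on isomorphism classes. $H_1\sqcup H_2$ denotes disjoint union. $f$ is multiplicative if $f(H_1\sqcup H_2)=f(H_1)\cdot f(H_2)$ for all disjoint graphs $H_1,H_2$. For $W\subseteq V(G)$, $N(W)=\bigcup_{w\in W}N(w)$, where $N(w)=\{v\in V(G): vw\in E(G)\}$. The $f$-vertex stability number is $vs_f(G)=\min\{|X|: X\subseteq V(G),\ f(G-X)\neq f(G)\}$, and $vs_f(G)=\infty$ if $f(G-X)=f(G)$ for all $X\subseteq V(G)$ ($X=V(G)$ is allowed). *)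

(* Defs.v *)
From HB Require Import structures.
From mathcomp Require Import all_boot all_order all_algebra.
From mathcomp Require Import all_reals ereal.

Set Implicit Arguments.
Unset Strict Implicit.
Unset Printing Implicit Defensive.

Import Order.TTheory GRing.Theory Num.Theory.
Local Open Scope ring_scope.

Record sgraph := SGraph {
  vertices :> finType;
  adj : rel vertices;
  adj_sym : symmetric adj;
  adj_irr : irreflexive adj }.

Definition graph_iso (G H : sgraph) : Prop :=
  exists2 h : G -> H, bijective h & forall x y, adj (h x) (h y) = adj x y.

Section Induced.
Variables (G : sgraph) (S : {set G}).

Definition induced_adj : rel {x : G | x \in S} :=
  fun x y => adj (val x) (val y).

Lemma induced_adj_sym : symmetric induced_adj.
Proof. by move=> x y; apply: adj_sym. Qed.

Lemma induced_adj_irr : irreflexive induced_adj.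
Proof. by move=> x; apply: adj_irr. Qed.

Definition induced : sgraph := SGraph induced_adj_sym induced_adj_irr.
End Induced.

Definition del (G : sgraph) (X : {set G}) : sgraph := induced (~: X).

Section DisjointUnion.
Variables H1 H2 : sgraph.

Definition dunion_adj : rel (H1 + H2)%type := fun x y =>
  match x, y with
  | inl a, inl b => adj a b
  | inr a, inr b => adj a b
  | _, _ => false
  end.

Lemma dunion_adj_sym : symmetric dunion_adj.
Proof. by move=> [x|x] [y|y] //=; apply: adj_sym. Qed.

Lemma dunion_adj_irr : irreflexive dunion_adj.
Proof. by move=> [x|x] /=; apply: adj_irr. Qed.

Definition dunion : sgraph := SGraph dunion_adj_sym dunion_adj_irr.
End DisjointUnion.

Definition nbr (G : sgraph) (w : G) : {set G} := [set v | adj v w].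

Definition nbrs (G : sgraph) (W : {set G}) : {set G} :=
  \bigcup_(w in W) nbr w.

Definition graph_invariant (R : realType) (f : sgraph -> R) : Prop :=
  (forall G, 0 <= f G) /\ (forall G H, graph_iso G H -> f G = f H).

Definition graph_multiplicative (R : realType) (f : sgraph -> R) : Prop :=
  forall H1 H2, f (dunion H1 H2) = f H1 * f H2.

(* The neutral element +oo is the value when no X changes f. *)
Definition vs (R : realType) (f : sgraph -> R) (G : sgraph) : \bar R :=
  \big[Order.min/+oo%E]_(X : {set G} | f (del X) != f G) (#|X|%:R)%:E.

(* Main.v *)
(* Deleting X from G disconnects H from the rest, so with Q the set of vertices
   outside H and X, f(G-X) = f(H) f(Q) and f(G-X-Y) = f(H-Y) f(Q). If Y changes
   f(H), these two values differ since f(Q) is nonzero, hence one of them is not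
   f(G), and X or the union of X and Y changes f(G). *)

Require Import Defs.
From mathcomp Require Import all_boot all_order all_algebra.
From mathcomp Require Import all_reals ereal.

Set Implicit Arguments.
Unset Strict Implicit.
Unset Printing Implicit Defensive.

Import Order.TTheory GRing.Theory Num.Theory.
Local Open Scope ring_scope.

(** [phi] corestricted to its image [C] stays injective, and equal cardinalities make it bijective,
    so no inverse into a subtype has to be built. *)
Lemma graph_iso_induced_codom (K G : sgraph) (phi : K -> G) (C : {set G}) :
  injective phi -> {mono phi : x y / adj x y} -> phi @: setT = C ->
  graph_iso K (induced C).
Proof.
move=> phi_inj phi_adj imC.
have phiC x : phi x \in C by rewrite -imC imset_f.
exists (fun x => exist _ (phi x) (phiC x)); last by move=> x y; apply: phi_adj.
apply: inj_card_bij; first by move=> x y [] /phi_inj.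
by rewrite card_sig -[X in (X <= _)%N]/#|C| -imC card_imset // cardsT.
Qed.

(** Carries multiplicativity, stated for a sum type, over to two vertex sets inside one graph. *)
Lemma graph_iso_induced_setU (G : sgraph) (A B : {set G}) :
  [disjoint A & B] -> {in A & B, forall a b, ~~ adj a b} ->
  graph_iso (dunion (induced A) (induced B)) (induced (A :|: B)).
Proof.
move=> dAB nAB.
pose phi (x : dunion (induced A) (induced B)) : G :=
  match x with inl a => val a | inr b => val b end.
apply: (@graph_iso_induced_codom _ _ phi).
- move=> [[a aA]|[b bB]] [[c cA]|[d dB]] /= e.
  + by congr inl; apply: val_inj.
  + by case/negP: (negbT (disjointFr dAB aA)); rewrite e.
  + by case/negP: (negbT (disjointFr dAB cA)); rewrite -e.
  + by congr inr; apply: val_inj.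
- move=> [[a aA]|[b bB]] [[c cA]|[d dB]] //=; first exact/negbTE/nAB.
  by rewrite adj_sym; exact/negbTE/nAB.
- apply/setP=> x; rewrite inE; apply/imsetP/orP.
    by move=> [[[a aA]|[b bB]] _ ->]; [left|right].
  by case=> xP; [exists (inl (exist _ x xP))|exists (inr (exist _ x xP))].
Qed.

(** Flattens the nested subtypes: applying [val] twice sends vertices of [del Y] to vertices of
    [G]. *)
Lemma graph_iso_del_induced (G : sgraph) (S : {set G}) (Y : {set induced S}) :
  graph_iso (del Y) (induced (S :\: val @: Y)).
Proof.
apply: (@graph_iso_induced_codom (del Y) G (fun x => val (val x))) => //.
  by move=> x y /val_inj /val_inj.
apply/setP=> x; rewrite inE; apply/imsetP/andP.
  move=> [[y yY] _ ->] /=; split; last exact: valP y.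
  by rewrite mem_imset; [rewrite inE in yY|exact: val_inj].
move=> [xY xS]; have yY : (exist _ x xS : induced S) \in ~: Y.
  by rewrite inE; apply: contra xY => /(imset_f val).
by exists (exist _ (exist _ x xS) yY).
Qed.

Lemma vs_le_card (R : realType) (f : sgraph -> R) (G : sgraph) (X : {set G}) :
  f (del X) != f G -> (vs f G <= (#|X|%:R)%:E)%E.
Proof. by move=> fX; apply: bigmin_le_cond. Qed.

Theorem theorem2p1 (R : realType) (f : sgraph -> R)
    (f_inv : graph_invariant f) (f_mul : graph_multiplicative f)
    (f_neq0 : forall F : sgraph, f F <> 0)
    (G : sgraph) (S : {set G}) :
  let H := induced S in
  let X := nbrs S :\: S in
  (vs f G <= (#|X|%:R)%:E + vs f H)%E.
Proof.
move=> /=; set H := induced S; set X := nbrs S :\: S.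
have [_ f_iso] := f_inv.
(* Induction over the minimum defining [vs f H]: the bound is trivial at +oo and passes to minima,
   which leaves a single [Y] that changes [f H]. *)
rewrite {2}/vs; elim/big_ind: _ => [|u v Gu Gv|Y fY].
- by rewrite addey ?leey.
- by rewrite /Order.min; case: ifP.
pose Q := ~: (S :|: nbrs S).
(* Used below with [A] equal to [S] and to [S] minus the image of [Y]. *)
have f_split (A : {set G}) : A \subset S ->
    f (induced (A :|: Q)) = f (induced A) * f (induced Q).
  move=> /subsetP AS; rewrite -f_mul; apply/esym/f_iso/graph_iso_induced_setU.
    by rewrite disjoint_subset; apply/subsetP=> x /AS xS; rewrite !inE xS.
  move=> a b /AS aS; rewrite !inE negb_or => /andP[_]; apply: contra => ab.
  by apply/bigcupP; exists a; rewrite // inE adj_sym.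
have fX : f (del X) = f H * f (induced Q).
  rewrite -f_split // /del; congr (f (induced _)).
  by apply/setP=> x; rewrite !inE; case: (x \in S).
have fXY : f (del (X :|: val @: Y)) = f (del Y) * f (induced Q).
  rewrite (f_iso _ _ (graph_iso_del_induced Y)) -f_split ?subsetDl // /del.
  congr (f (induced _)); apply/setP=> x; rewrite !inE.
  (* The image of [Y] lies in [S], hence misses [Q]. *)
  have [/imsetP[y _ ->]|_] := boolP (x \in val @: Y); last first.
    by case: (x \in S); rewrite ?orbF.
  by rewrite (valP y) orbT.
have [fGX|fGX] := eqVneq (f (del X)) (f G); last first.
  by apply: le_trans (vs_le_card fGX) _; rewrite leeDl // lee_fin ler0n.
have fGXY : f (del (X :|: val @: Y)) != f G.
  (* Cancelling the nonzero factor [f (induced Q)] reduces the claim to [fY]. *)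
  by rewrite -fGX fX fXY (inj_eq (mulIf _)) //; apply/eqP.
apply: le_trans (vs_le_card fGXY) _.
rewrite -EFinD lee_fin -natrD ler_nat (leq_trans (leq_card_setU _ _)) //.
by rewrite leq_add2l leq_imset_card.
Qed.
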